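(* Let $L/K$ be a finite Galois extension of number fields and $\rho:\mathrm{Gal}(L/K)\to\mathrm{GL}(V)$ a finite-dimensional complex representation. Then in $\mathcal{A}_K$ $$\mathcal{L}(\mathfrak{X}_K,\rho;L/K)=\sum_{\lambda^\bullet\in\mathbb{Y}_K}\mathrm{Tr}_{\eta_{\lambda^\bullet}(W_\rho)}(\sigma_K)\,m_{\lambda^\bullet}[\mathfrak{X}_K].$$
   Context: Ring: for a number field $K$ with ring of integers $\mathcal{O}_K$, $\mathbb{P}_K$ is the set of (nonzero) prime ideals and $\mathcal{J}_K^+$ the monoid of (nonzero) integral ideals. $\mathbb{Q}^{\mathrm{ab}}\subset\mathbb{C}$ is the maximal abelian extension of $\mathbb{Q}$ and $\Lambda$ the ring of symmetric functions over $\mathbb{Q}^{\mathrm{ab}}$. For each $\mathfrak{q}\in\mathbb{P}_K$, $\mathfrak{X}^{(\mathfrak{q})}=x_1^{(\mathfrak{q})}+x_2^{(\mathfrak{q})}+\cdots$ is a set of commuting free variables, $\mathfrak{X}_K=(\mathfrak{X}^{(\mathfrak{q})})_{\mathfrak{q}}$; $A_K:=\bigotimes_{\mathfrak{q}}\Lambda[\mathfrak{X}^{(\mathfrak{q})}]$ (direct limit over finite subsets of $\mathbb{P}_K$), graded by $\mathcal{J}_K^+$ (multidegree $(d_{\mathfrak{q}})$ corresponds to $\prod\mathfrak{q}^{d_{\mathfrak{q}}}$), and $\mathcal{A}_K$ is its completion (formal sums of one homogeneous element for each $\mathfrak{a}\in\mathcal{J}_K^+$). $\mathbb{Y}_K$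 is the set of tuples $\lambda^\bullet=(\lambda^{(\mathfrak{q})})_{\mathfrak{q}\in\mathbb{P}_K}$ of partitions, almost all empty, and $m_{\lambda^\bullet}[\mathfrak{X}_K]=\prod_{\mathfrak{q}}m_{\lambda^{(\mathfrak{q})}}[\mathfrak{X}^{(\mathfrak{q})}]$ with $m_\lambda$ the monomial symmetric functions. Artin symmetric function: for each $\mathfrak{q}\in\mathbb{P}_K$ choose a prime $\mathfrak{p}$ of $L$ over $\mathfrak{q}$; let $I(\mathfrak{q})\subset D(\mathfrak{q})\subset\mathrm{Gal}(L/K)$ be its inertia and decomposition groups and $\sigma_{\mathfrak{q}}\in D(\mathfrak{q})/I(\mathfrak{q})$ the Frobenius element. Then $\mathcal{L}(\mathfrak{X}_K,\rho;L/K):=\prod_{\mathfrak{q}}\prod_{i\ge1}\det\left(\mathrm{Id}_{V^{I(\mathfrak{q})}}-x_i^{(\mathfrak{q})}\rho(\sigma_{\mathfrak{q}})|_{V^{I(\mathfrak{q})}}\right)^{-1}\in\mathcal{A}_K$. Representations: $G_{L/K}:=\prod_{\mathfrak{q}\in\mathbb{P}_K}N_{\mathrm{Gal}(L/K)}(I(\mathfrak{q}))/I(\mathfrak{q})$, where $N_G(H)$ is the normalizer; $\sigma_K:=(\sigma_{\mathfrak{q}})_{\mathfrak{q}}\in G_{L/K}$. $V_{\mathfrak{q}}$ is the space $V^{I(\mathfrak{q})}$ on which $G_{L/K}$ acts through its $\mathfrak{q}$-component $N_{\mathrm{Gal}(L/K)}(I(\mathfrak{q}))/I(\mathfrak{q})$.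 $W_\rho:=\bigotimes_{\mathfrak{q}}V_{\mathfrak{q}}$ (a factored representation). For a partition $\lambda=(\lambda_1,\dots,\lambda_r)$ and a representation $W$, $\eta_\lambda(W):=\mathrm{Sym}^{\lambda_1}(W)\otimes\cdots\otimes\mathrm{Sym}^{\lambda_r}(W)$ (trivial one-dimensional if $\lambda=\emptyset$), and $\eta_{\lambda^\bullet}(W_\rho):=\bigotimes_{\mathfrak{q}}\eta_{\lambda^{(\mathfrak{q})}}(V_{\mathfrak{q}})$, which is a finite-dimensional representation of $G_{L/K}$ because $\lambda^{(\mathfrak{q})}=\emptyset$ for almost all $\mathfrak{q}$. *)

(* Defs.v *)
From HB Require Import structures.
From mathcomp Require Import all_boot all_order all_algebra all_fingroup all_field all_character.
From mathcomp Require Import finmap.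
From mathcomp Require Import boolp classical_sets functions cardinality fsbigop reals.
From mathcomp Require Import complex.
From mathcomp Require Import mpoly.

Set Implicit Arguments.
Unset Strict Implicit.
Unset Printing Implicit Defensive.

Import GRing.Theory.

Local Open Scope ring_scope.

(* Commutative monomials over an arbitrary, possibly infinite, set of variables
   I; the value of a monomial at i is the exponent of the variable i. *)
Definition monom (I : choiceType) := {fsfun I -> nat with 0%N}.


Definition monom1 (I : choiceType) : monom I := [fsfun].

Definition monomU (I : choiceType) (i : I) : monom I :=
  [fsfun j in [fset i]%fset => 1%N | 0%N].

Definition monomM (I : choiceType) (u v : monom I) : monom I :=
  [fsfun i in (finsupp u `|` finsupp v)%fset => (u i + v i)%N | 0%N].

Lemma monomME (I : choiceType) (u v : monom I) i :
  monomM u v i = (u i + v i)%N.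
Proof.
rewrite fsfunE; case: ifP => // /negbT.
by rewrite in_fsetU negb_or => /andP[/fsfun_dflt -> /fsfun_dflt ->].
Qed.

Lemma monomMC (I : choiceType) : commutative (@monomM I).
Proof. by move=> u v; apply/fsfunP => i; rewrite !monomME addnC. Qed.

Lemma monomMA (I : choiceType) : associative (@monomM I).
Proof. by move=> u v w; apply/fsfunP => i; rewrite !monomME addnA. Qed.

Lemma monomM1 (I : choiceType) : left_id (monom1 I) (@monomM I).
Proof. by move=> u; apply/fsfunP => i; rewrite monomME fsfun0E. Qed.

Definition monom_split (I : choiceType) (m : monom I) : set (monom I * monom I) :=
  [set p | monomM p.1 p.2 = m]%classic.

Lemma finite_monom_split (I : choiceType) (m : monom I) :
  finite_set (monom_split m).
Proof.
pose S := finsupp m; pose B := (\sum_(i <- S) m i)%N.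
pose u (g : {ffun S -> 'I_B.+1}) : monom I :=
  [fsfun i : S => (g i : nat) | 0%N].
pose v (g : {ffun S -> 'I_B.+1}) : monom I :=
  [fsfun i : S => (m (val i) - g i)%N | 0%N].
apply: (@sub_finite_set _ _ [set (u g, v g) | g in setT]%classic); last first.
  by apply: finite_image; apply: finite_finset.
move=> [a b] /= ab; have mE i : m i = (a i + b i)%N by rewrite -ab monomME.
have mB i : (m i <= B)%N.
  case: (boolP (i \in S)) => [iS|/fsfun_dflt -> //].
  by rewrite /B (big_fsetD1 i iS) leq_addr.
have aB i : (a i < B.+1)%N by rewrite ltnS (leq_trans _ (mB i)) ?mE ?leq_addr.
exists [ffun i : S => Ordinal (aB (val i))] => //.
congr pair; apply/fsfunP => i; rewrite fsfun_ffun.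
- case: insubP => [j jS ji|iS]; first by rewrite /= ffunE -ji.
  by have := fsfun_dflt iS; rewrite mE; case: (a i).
- case: insubP => [j jS ji|iS]; first by rewrite /= ffunE -ji mE addKn.
  by have := fsfun_dflt iS; rewrite mE => /eqP; rewrite addn_eq0 => /andP[_ /eqP].
Qed.

(* Formal power series in the variables I: a series is its coefficient function.
   The product defined below is the Cauchy product, not the pointwise product
   that `monom I -> R` inherits from mathcomp.classical.functions. *)
Definition pseries (I : choiceType) (R : Type) := monom I -> R.

HB.instance Definition _ (I : choiceType) (R : comNzRingType) :=
  GRing.Zmodule.copy (pseries I R) (monom I -> R).

Section PSeriesRing.
Variables (I : choiceType) (R : comNzRingType).
Implicit Types (F G H : pseries I R) (m : monom I).

Definition psC (c : R) : pseries I R := fun m => if m == monom1 I then c else 0.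

Definition psmul F G : pseries I R := fun m =>
  \sum_(p \in monom_split m) F p.1 * G p.2.

Let split m := fset_set (monom_split m).

Let in_split m p : (p \in split m) = (monomM p.1 p.2 == m).
Proof.
by rewrite in_fset_set ?in_setE; last exact: finite_monom_split; apply/idP/eqP; rewrite in_setE.
Qed.

Lemma psmulE F G m :
  psmul F G m = \sum_(p <- fset_set (monom_split m)) F p.1 * G p.2.
Proof. by rewrite /psmul fsbig_finite //; apply: finite_monom_split. Qed.

Lemma psmulC : commutative psmul.
Proof.
move=> F G; apply/funext => m; rewrite !psmulE.
pose sw (p : monom I * monom I) := (p.2, p.1).
have -> : \sum_(p <- split m) F p.1 * G p.2 =
          \sum_(p <- [seq sw p | p <- split m]) G p.1 * F p.2.
  by rewrite big_map; apply: eq_bigr => p _; rewrite mulrC.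
apply: perm_big; apply: uniq_perm; rewrite ?map_inj_uniq ?fset_uniq //.
  by move=> [a b] [c d] [-> ->].
move=> [a b]; rewrite in_split /= monomMC; apply/mapP/idP => /=.
  by case=> -[c d]; rewrite in_split /= => /eqP <- [-> ->].
by move=> ab; exists (b, a); rewrite ?in_split.
Qed.

Lemma psmulA : associative psmul.
Proof.
move=> F G H; apply/funext => m; rewrite !psmulE.
pose r1 := [seq (p.1, (q.1, q.2)) | p <- split m, q <- split p.2].
pose r2 := [seq (q.1, (q.2, p.2)) | p <- split m, q <- split p.1].
transitivity (\sum_(t <- r1) F t.1 * (G t.2.1 * H t.2.2)).
  rewrite big_allpairs_dep /=; apply: eq_bigr => p _.
  by rewrite psmulE mulr_sumr.
transitivity (\sum_(t <- r2) F t.1 * (G t.2.1 * H t.2.2)); last first.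
  rewrite big_allpairs_dep /=; apply: eq_bigr => p _.
  by rewrite psmulE mulr_suml; apply: eq_bigr => q _; rewrite mulrA.
apply: perm_big; apply: uniq_perm.
- apply: allpairs_uniq_dep => [|p _|]; rewrite ?fset_uniq // => u v.
  case/allpairsPdep=> -[a b] [[c d] [_ + ->]] /=.
  rewrite in_split => /= /eqP <-.
  case/allpairsPdep=> -[a' b'] [[c' d'] [_ + ->]] /=.
  by rewrite in_split => /= /eqP <- [-> -> ->].
- apply: allpairs_uniq_dep => [|p _|]; rewrite ?fset_uniq // => u v.
  case/allpairsPdep=> -[a b] [[c d] [_ + ->]] /=.
  rewrite in_split => /= /eqP <-.
  case/allpairsPdep=> -[a' b'] [[c' d'] [_ + ->]] /=.
  by rewrite in_split => /= /eqP <- [-> -> ->].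
move=> [a [b c]]; apply/allpairsPdep/allpairsPdep => -[[u v] [[u' v']]] [].
  rewrite !in_split => /= /eqP <- /eqP <- [-> -> ->].
  by exists (monomM u u', v'), (u, u'); rewrite !in_split monomMA.
rewrite !in_split => /= /eqP <- /eqP <- [-> -> ->].
by exists (u', monomM v' v), (v', v); rewrite !in_split monomMA.
Qed.

Lemma psmul1 : left_id (psC 1) psmul.
Proof.
move=> F; apply/funext => m; rewrite psmulE.
have i1 : (monom1 I, m) \in split m by rewrite in_split /= monomM1.
rewrite (bigD1_seq _ i1) ?fset_uniq //= /psC eqxx mul1r big1_seq ?addr0 //.
move=> [a b] /andP[/= ne]; rewrite in_split /= => /eqP ab.
case: eqP => [a1|_]; last by rewrite mul0r.
by move: ne; rewrite -ab a1 monomM1 eqxx.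
Qed.

Lemma psmulDl : left_distributive psmul +%R.
Proof.
move=> F G H; apply/funext => m.
change (psmul (F + G) H m = psmul F H m + psmul G H m).
rewrite !psmulE -big_split; apply: eq_bigr => p _ /=.
exact: (mulrDl (F p.1) (G p.1) (H p.2)).
Qed.

Lemma psC1_neq0 : psC 1 != 0.
Proof.
apply/eqP => /(congr1 (fun F : pseries I R => F (monom1 I))) /eqP.
by rewrite /psC eqxx oner_eq0.
Qed.

HB.instance Definition _ := GRing.Zmodule_isComNzRing.Build (pseries I R)
  psmulA psmulC psmul1 psmulDl psC1_neq0.

Definition psunit : pred (pseries I R) := fun F => `[< exists G, G * F = 1 >].

Definition psinv F : pseries I R :=
  xget F [set G | G * F = 1]%classic.

Lemma psmulV : {in psunit, left_inverse 1 psinv *%R}.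
Proof.
move=> F /asboolP uF; rewrite /psinv; case: xgetP => [G _ //|nF].
by case: uF => G GF; case: (nF G).
Qed.

Lemma psunitP F G : G * F = 1 -> psunit F.
Proof. by move=> GF; apply/asboolP; exists G. Qed.

Lemma psinv_out : {in [predC psunit], psinv =1 id}.
Proof.
move=> F /negP nF; rewrite /psinv; case: xgetP => // G _ GF.
by case: nF; apply/asboolP; exists G.
Qed.

HB.instance Definition _ := GRing.ComNzRing_hasMulInverse.Build (pseries I R)
  psmulV psunitP psinv_out.

End PSeriesRing.

Definition is_algint (F : fieldType) : {pred F} :=
  fun x => `[< integralOver (intr : int -> F) x >].

Lemma is_algint_subring (F : fieldType) : subring_closed (@is_algint F).
Proof.
split=> [|x y /asboolP Ix /asboolP Iy|x y /asboolP Ix /asboolP Iy]; apply/asboolP.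
- exact: integral1.
- exact: integral_sub.
- exact: integral_mul.
Qed.

HB.instance Definition _ (F : fieldType) :=
  GRing.isSubringClosed.Build F (@is_algint F) (@is_algint_subring F).

Record ringOfInt (F : fieldType) :=
  RingOfInt { algint :> F; algintP : algint \in @is_algint F }.

HB.instance Definition _ (F : fieldType) := [isSub for @algint F].
HB.instance Definition _ (F : fieldType) := [Choice of ringOfInt F by <:].
HB.instance Definition _ (F : fieldType) :=
  [SubChoice_isSubComNzRing of ringOfInt F by <:].

(* Nonzero prime ideals of the ring of integers; idealr_closed includes
   properness (1 is not a member). *)
Record primeIdeal (F : fieldType) := PrimeIdeal {
  prime_mem :> ringOfInt F -> bool;
  prime_mem_idealr : idealr_closed prime_mem;
  prime_mem_prime : prime_idealr_closed prime_mem;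
  prime_mem_neq0 : exists2 x, prime_mem x & x != 0
}.

HB.instance Definition _ (F : fieldType) (q : primeIdeal F) :=
  isIdealr.Build (ringOfInt F) q (prime_mem_idealr q).
HB.instance Definition _ (F : fieldType) (q : primeIdeal F) :=
  isPrimeIdealrClosed.Build (ringOfInt F) q (@prime_mem_prime F q).

HB.instance Definition _ (F : fieldType) := gen_eqMixin (primeIdeal F).
HB.instance Definition _ (F : fieldType) := gen_choiceMixin (primeIdeal F).

Definition absNorm (F : fieldType) (q : primeIdeal F) : nat :=
  #|` fset_set
       [set: {ideal_quot (prime_mem q : idealr (ringOfInt F))}]%classic|.

Section Extension.
Variables (K : fieldExtType rat) (L : splittingFieldType K).

Lemma ringOfInt_in_subproof (x : ringOfInt K) : (val x)%:A \in @is_algint L.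
Proof.
apply/asboolP; have [p p_monic px] := asboolP _ (algintP x).
exists p => //.
have -> : map_poly (intr : int -> L) p = map_poly (in_alg L) (map_poly (intr : int -> K) p).
  rewrite -map_poly_comp; apply: eq_map_poly => z.
  exact: esym (rmorph_int (in_alg L) z).
by rewrite fmorph_root.
Qed.

Definition ringOfInt_in (x : ringOfInt K) : ringOfInt L :=
  RingOfInt (ringOfInt_in_subproof x).

Definition lies_over (p : primeIdeal L) (q : primeIdeal K) : Prop :=
  forall x : ringOfInt K, (ringOfInt_in x \in prime_mem p) = (x \in prime_mem q).

Lemma ringOfInt_gal_subproof (s : gal_of {:L}) (x : ringOfInt L) :
  s (val x) \in @is_algint L.
Proof.
apply/asboolP; have [p p_monic px] := asboolP _ (algintP x).
exists p => //.
have -> : map_poly (intr : int -> L) p = map_poly s (map_poly (intr : int -> L) p).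
  rewrite -map_poly_comp; apply: eq_map_poly => z.
  exact: esym (rmorph_int s z).
by rewrite fmorph_root.
Qed.

Definition ringOfInt_gal (s : gal_of {:L}) (x : ringOfInt L) : ringOfInt L :=
  RingOfInt (ringOfInt_gal_subproof s x).

Lemma ringOfInt_gal1 x : ringOfInt_gal 1%g x = x.
Proof. by apply: val_inj; rewrite /= gal_id. Qed.

Lemma ringOfInt_galM s t x :
  ringOfInt_gal (s * t)%g x = ringOfInt_gal t (ringOfInt_gal s x).
Proof. by apply: val_inj; rewrite /= galM ?memvf. Qed.

Lemma ringOfInt_galB s x y :
  ringOfInt_gal s (x - y) = ringOfInt_gal s x - ringOfInt_gal s y.
Proof. by apply: val_inj; rewrite /= rmorphB. Qed.

(* In gal_of, (s * t) x = t (s x). Matrix representations act on row vectors from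
   the right, so v |-> v *m rho s is a linear action of the Galois group for the
   usual composition of automorphisms. *)
Definition galLK : {group gal_of {:L}} := 'Gal({:L} / 1%AS)%G.

Definition decomposition (p : primeIdeal L) : {set gal_of {:L}} :=
  [set s in galLK |
    `[< forall x, (ringOfInt_gal s x \in prime_mem p) = (x \in prime_mem p) >]].

Definition inertia (p : primeIdeal L) : {set gal_of {:L}} :=
  [set s in decomposition p | `[< forall x, ringOfInt_gal s x - x \in prime_mem p >]].

Lemma inertia_group_set p : group_set (inertia p).
Proof.
apply/group_setP; split=> [|s t].
  rewrite !inE group1 /=; apply/andP; split; apply/asboolP => x.
    by rewrite ringOfInt_gal1.
  by rewrite ringOfInt_gal1 subrr rpred0.
rewrite !inE => /andP[/andP[sG /asboolP sD] /asboolP sI].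
move=> /andP[/andP[tG /asboolP tD] /asboolP tI].
rewrite groupM //=; apply/andP; split; apply/asboolP => x; rewrite ringOfInt_galM.
  by rewrite tD.
rewrite -[X in X - x](subrK (ringOfInt_gal s x)) -addrA.
by rewrite rpredD ?sI ?tI.
Qed.
Canonical inertia_group p := Group (inertia_group_set p).

Lemma inertia_sub p : inertia p \subset galLK.
Proof. by apply/fintype.subsetP => s; rewrite !inE => /andP[/andP[]]. Qed.

(* The Frobenius class in D / I: it acts on O_L / p as the #|O_K / q|-th power
   map. *)
Definition is_Frobenius (q : primeIdeal K) (p : primeIdeal L)
    (sigma : coset_of (inertia p)) : Prop :=
  exists s, [/\ s \in decomposition p, sigma = coset (inertia p) s
    & forall x, ringOfInt_gal s x - x ^+ absNorm q \in prime_mem p].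

End Extension.

Definition prodGroup (I : Type) (G : I -> groupType) := forall i, G i.

Section ProdGroup.
Variables (I : Type) (G : I -> groupType).
Implicit Types g h k : prodGroup G.

HB.instance Definition _ := Choice.copy (prodGroup G) (forall i, G i).

Definition prodGroup_one : prodGroup G := fun=> 1%g.
Definition prodGroup_mul g h : prodGroup G := fun i => (g i * h i)%g.
Definition prodGroup_inv g : prodGroup G := fun i => (g i)^-1%g.

Fact prodGroup_mulA : associative prodGroup_mul.
Proof.
by move=> g h k; apply/functional_extensionality_dep => i;
  rewrite /prodGroup_mul mulgA.
Qed.

Fact prodGroup_mul1 : left_id prodGroup_one prodGroup_mul.
Proof.
by move=> g; apply/functional_extensionality_dep => i;
  rewrite /prodGroup_mul mul1g.
Qed.

Fact prodGroup_mulr1 : right_id prodGroup_one prodGroup_mul.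
Proof.
by move=> g; apply/functional_extensionality_dep => i;
  rewrite /prodGroup_mul mulg1.
Qed.

Fact prodGroup_mulV : left_inverse prodGroup_one prodGroup_inv prodGroup_mul.
Proof.
by move=> g; apply/functional_extensionality_dep => i;
  rewrite /prodGroup_mul mulVg.
Qed.

Fact prodGroup_mulrV : right_inverse prodGroup_one prodGroup_inv prodGroup_mul.
Proof.
by move=> g; apply/functional_extensionality_dep => i;
  rewrite /prodGroup_mul mulgV.
Qed.

HB.instance Definition _ := isGroup.Build (prodGroup G)
  prodGroup_mulA prodGroup_mul1 prodGroup_mulr1 prodGroup_mulV prodGroup_mulrV.
End ProdGroup.

(* Finite-dimensional matrix representations of a group that need not be finite
   (mx_representation requires a finGroupType). *)
Record frep (F : fieldType) (G : groupType) := FRep {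
  frep_dim : nat;
  frep_mx :> G -> 'M[F]_frep_dim;
  frep_mx1 : frep_mx 1%g = 1%:M;
  frep_mxM : forall g h, frep_mx (g * h)%g = frep_mx g *m frep_mx h
}.

Section SymPower.
Variable F : fieldType.

(* Sym^k of the space with basis e_0, ..., e_(n-1) is the space of homogeneous
   polynomials of degree k in the 'X_i = e_i. A matrix A sends e_i to
   \sum_j A i j e_j (right action on row vectors), hence acts on polynomials by
   linear substitution; sym_mx is the matrix of that action in the basis of the
   monomials of degree k. *)
Definition sym_basis (n k : nat) : {set 'X_{1..n < k.+1}} :=
  [set m : 'X_{1..n < k.+1} | mdeg m == k].

Definition sym_monom (n k : nat) (a : 'I_#|sym_basis n k|) : 'X_{1..n} :=
  bmnm (enum_val a).

Definition linsubst (n : nat) (A : 'M[F]_n) (p : {mpoly F[n]}) : {mpoly F[n]} :=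
  p \mPo [tuple \sum_(j < n) A i j *: 'X_j | i < n].

Definition sym_mx (n k : nat) (A : 'M[F]_n) : 'M[F]_#|sym_basis n k| :=
  \matrix_(a < #|sym_basis n k|, b < #|sym_basis n k|)
    (linsubst A 'X_[sym_monom a])@_(sym_monom b).

Lemma linsubstM n (A B : 'M[F]_n) p :
  linsubst (A *m B) p = linsubst B (linsubst A p).
Proof.
rewrite [RHS]/linsubst [X in X \mPo _]comp_mpolyEX [LHS]comp_mpolyEX raddf_sum /=.
apply: eq_bigr => m _; rewrite comp_mpolyZ; congr (_ *: _).
rewrite !comp_mpolyX rmorph_prod /=; apply: eq_bigr => i _.
rewrite rmorphXn /= !tnth_mktuple raddf_sum /=; congr (_ ^+ _).
transitivity (\sum_(j < n) A i j *: \sum_(k < n) B j k *: ('X_k : {mpoly F[n]})); last first.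
  by apply: eq_bigr => j _; rewrite linearZ /= comp_mpolyXU -tnth_nth tnth_mktuple.
under [RHS]eq_bigr do rewrite scaler_sumr.
rewrite exchange_big /=; apply: eq_bigr => k _.
by rewrite mxE scaler_suml; apply: eq_bigr => j _; rewrite scalerA.
Qed.

Lemma linsubst1 n p : linsubst (1%:M : 'M[F]_n) p = p.
Proof.
rewrite -[RHS]comp_mpoly_id; congr (_ \mPo _); apply: eq_from_tnth => i.
rewrite !tnth_mktuple (bigD1 i) //= big1 ?addr0; first by rewrite mxE eqxx scale1r.
by move=> j ji; rewrite mxE eq_sym (negPf ji) scale0r.
Qed.

Lemma linsubst_homog n k (A : 'M[F]_n) p :
  p \is k.-homog -> linsubst A p \is k.-homog.
Proof.
move=> ph; rewrite /linsubst comp_mpolyE big_seq rpred_sum // => m mp.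
apply: rpredZ; have <- : mdeg m = k by have /dhomogP := ph; apply.
rewrite mdegE; elim/big_rec2: _ => [|i q d _ qd]; first exact: dhomog1.
rewrite addnC mulrC; apply: dhomogM => //; rewrite -[m i in X in X.-homog]mul1n.
apply: dhomogMn; rewrite tnth_mktuple rpred_sum // => j _.
by apply: rpredZ; rewrite dhomogX; apply/eqP; exact: mdeg1.
Qed.

Lemma dhomog_sym_basis n k (p : {mpoly F[n]}) : p \is k.-homog ->
  p = \sum_(c < #|sym_basis n k|)
        p@_(sym_monom c) *: 'X_[sym_monom c].
Proof.
move=> ph; rewrite /sym_monom.
rewrite -(@big_enum_val _ _ _ _ (mem (sym_basis n k)) (fun m : 'X_{1..n < k.+1} => p@_m *: 'X_[m])).
have sz : (msize p <= k.+1)%N.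
  rewrite msizeE; apply/bigmax_leqP_seq => m mp _.
  by have /dhomogP -> := ph.
rewrite [LHS](mpolywE sz) [LHS](bigID (mem (sym_basis n k))) /=.
rewrite [X in _ + X]big1 ?addr0 // => m; rewrite inE => mk.
by rewrite (dhomog_nemf_coeff ph mk) scale0r.
Qed.

Lemma sym_mxM n k (A B : 'M[F]_n) : sym_mx k (A *m B) = sym_mx k A *m sym_mx k B.
Proof.
apply/matrixP => a b; rewrite !mxE linsubstM.
rewrite [X in linsubst B X](@dhomog_sym_basis n k); last first.
  by apply: linsubst_homog; rewrite dhomogX; have := enum_valP a; rewrite inE.
rewrite {1}/linsubst; set lq := [tuple _ | i < n].
rewrite (linear_sum (comp_mpoly lq)) (raddf_sum (mcoeff _)).
by apply: eq_bigr => c _; rewrite !mxE /= comp_mpolyZ mcoeffZ.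
Qed.

Lemma sym_mx1 n k : sym_mx k (1%:M : 'M[F]_n) = 1%:M.
Proof.
apply/matrixP => a b; rewrite !mxE linsubst1 mcoeffX.
by rewrite (inj_eq val_inj) (inj_eq enum_val_inj).
Qed.
End SymPower.

Section FrepOps.
Variables (F : fieldType) (G : groupType).
Implicit Types U W : frep F G.

Fact triv_frepM (g h : G) : 1%:M = 1%:M *m 1%:M :> 'M[F]_1.
Proof. by rewrite mulmx1. Qed.

Definition triv_frep : frep F G := @FRep F G 1 (fun=> 1%:M) (erefl _) triv_frepM.

Definition tens_mx U W (g : G) := tprod (U g) (W g).

Fact tens_mx1 U W : tens_mx U W 1%g = 1%:M.
Proof. by rewrite /tens_mx !frep_mx1 tprod1. Qed.

Fact tens_mxM U W g h : tens_mx U W (g * h)%g = tens_mx U W g *m tens_mx U W h.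
Proof. by rewrite /tens_mx !frep_mxM tprodE. Qed.

Definition tens_frep U W : frep F G := FRep (tens_mx1 U W) (tens_mxM U W).

Fact sym_frep1 k W : sym_mx k (W 1%g) = 1%:M.
Proof. by rewrite frep_mx1 sym_mx1. Qed.

Fact sym_frepM k W g h :
  sym_mx k (W (g * h)%g) = sym_mx k (W g) *m sym_mx k (W h).
Proof. by rewrite frep_mxM sym_mxM. Qed.

Definition sym_frep k W : frep F G :=
  @FRep F G _ (fun g => sym_mx k (W g)) (sym_frep1 k W) (sym_frepM k W).

End FrepOps.

Definition is_partition (s : seq nat) : bool := sorted geq s && (0%N \notin s).
Definition partition := {s : seq nat | is_partition s}.
HB.instance Definition _ := Choice.on partition.

Definition empty_partition : partition := exist _ [::] isT.

Definition partition_tuple (P : choiceType) :=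
  {fsfun P -> partition with empty_partition}.

Definition eta (F : fieldType) (G : groupType) (lam : partition) (W : frep F G) :
    frep F G :=
  foldr (fun k => tens_frep (sym_frep k W)) (triv_frep F G) (val lam).

(* V is the family of the factors of a factored representation W = \bigotimes_q V q;
   the components of lam outside its support are empty and contribute trivial
   one-dimensional factors. *)
Definition eta_tuple (P : choiceType) (F : fieldType) (G : groupType)
    (lam : partition_tuple P) (V : P -> frep F G) : frep F G :=
  \big[@tens_frep F G/triv_frep F G]_(q <- finsupp lam) eta (lam q) (V q).

Section ArtinRep.
Variables (K : fieldExtType rat) (L : splittingFieldType K).
Variables (C : fieldType) (n : nat) (rho : mx_representation C (galLK L) n).

Definition inertia_quo (p : primeIdeal L) : {group coset_of (inertia p)} :=
  ('N_(galLK L)(inertia p) / inertia p)%G.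

Lemma inertia_normal p : (inertia p <| 'N_(galLK L)(inertia p))%g.
Proof. by rewrite normalSG ?inertia_sub. Qed.

Definition norm_repr p := subg_repr rho (subsetIl (galLK L) 'N(inertia p)%g).

Definition inv_mod p : mxmodule (norm_repr p) (rfix_mx (norm_repr p) (inertia p)) :=
  normal_rfix_mx_module (norm_repr p) (inertia_normal p).

Lemma inv_mod_rker p : inertia p \subset rker (submod_repr (inv_mod p)).
Proof.
by rewrite rker_submod rfix_mx_rstabC ?normal_sub ?inertia_normal.
Qed.

(* The representation of N(I) / I on the space of inertia invariants V^I. *)
Definition inv_repr p : mx_representation C (inertia_quo p)
    (\rank (rfix_mx (norm_repr p) (inertia p))) :=
  quo_repr (inv_mod_rker p) (normal_norm (inertia_normal p)).

Variable pr : primeIdeal K -> primeIdeal L.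

Definition GLK := prodGroup (fun q : primeIdeal K => [subg (inertia_quo (pr q))]).

Definition inv_act (q : primeIdeal K) (g : GLK) := inv_repr (pr q) (sgval (g q)).

Fact inv_act1 q : inv_act q 1%g = 1%:M.
Proof. exact: repr_mx1. Qed.

Fact inv_actM q g h : inv_act q (g * h)%g = inv_act q g *m inv_act q h.
Proof. by rewrite -repr_mxM ?subgP. Qed.

(* V_q; the family inv_frep is W_rho = \bigotimes_q V_q. *)
Definition inv_frep (q : primeIdeal K) : frep C GLK :=
  FRep (inv_act1 q) (inv_actM q).

End ArtinRep.

Section Limits.
Variables (I : choiceType) (R : comNzRingType) (T : choiceType).
Implicit Types (u : {fset T} -> pseries I R) (f : T -> pseries I R).

(* Infinite sums and products: every coefficient is eventually constant along the
   directed set of finite subsets of the index type. *)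
Definition is_pslim u (F : pseries I R) : Prop :=
  forall m, exists S0 : {fset T}, forall S : {fset T},
    (S0 `<=` S)%fset -> u S m = F m.

Definition has_sum f := is_pslim (fun S => \sum_(t <- S) f t).
Definition has_prod f := is_pslim (fun S => \prod_(t <- S) f t).

Definition summable f : Prop := exists F, has_sum f F.
Definition prodable f : Prop := exists F, has_prod f F.

(* Junk value 0 when the family is not summable (resp. prodable). *)
Definition pssum f : pseries I R := xget 0 (has_sum f).
Definition psprod f : pseries I R := xget 0 (has_prod f).
End Limits.

Definition psX (I : choiceType) (R : comNzRingType) (i : I) : pseries I R :=
  fun m => (m == monomU i)%:R.

(* The maximal abelian extension of Q in C, as the union of the images of all
   embeddings of finite abelian extensions of Q. *)
Definition Qab (C : fieldType) (z : C) : Prop :=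
  exists (E : splittingFieldType rat) (iota : {rmorphism E -> C}),
    [/\ galois 1%AS {:E}, abelian 'Gal({:E} / 1%AS) & exists a, z = iota a].

Section SymmetricFunctions.
Variables (P : choiceType) (C : fieldType).
Implicit Types (F : pseries (P * nat)%type C) (m : monom (P * nat)%type).

Definition multideg m (q : P) : nat := (\sum_(x <- finsupp m | x.1 == q) m x)%N.

Definition totdeg m : nat := (\sum_(x <- finsupp m) m x)%N.

(* The variable (q, i) is the i-th variable of the alphabet X^(q), numbered from 0;
   sym_fun q F says that F lies in Lambda[X^(q)]. *)
Definition sym_fun (q : P) F : Prop :=
  [/\ forall m, Qab (F m),
      forall m x, F m != 0 -> x \in finsupp m -> x.1 = q,
      exists d, forall m, F m != 0 -> (totdeg m <= d)%N
    & forall (s : nat -> nat) m m', bijective s ->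
        (forall i, m' (q, i) = m (q, s i)) ->
        (forall q' i, q' != q -> m' (q', i) = m (q', i)) ->
        F m' = F m].

(* The algebra A_K = \bigotimes_q Lambda[X^(q)], realised inside the power series
   ring as the finite sums of finite products of elements of the factors. *)
Definition tensor_sym_fun F : Prop :=
  exists (r : nat) (S : 'I_r -> {fset P}) (f : 'I_r -> P -> pseries (P * nat)%type C),
    (forall k q, sym_fun q (f k q)) /\
    F = \sum_(k < r) \prod_(q <- S k) f k q.

Definition homog_part (d : P -> nat) F : pseries (P * nat)%type C :=
  fun m => if `[< multideg m = d >] then F m else 0.

(* The completion of A_K: formal sums of one homogeneous element of A_K for each
   multidegree. The multidegree d stands for the ideal \prod_q q ^ (d q); if d has
   infinite support, the homogeneous part is 0. *)
Definition in_AK F : Prop :=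
  forall d : P -> nat, tensor_sym_fun (homog_part d F).

(* The sum of all distinct monomials in X^(q) whose nonzero exponents form a
   rearrangement of lam. *)
Definition msf (q : P) (lam : partition) : pseries (P * nat)%type C :=
  fun m => (all (fun x => x.1 == q) (finsupp m) &&
            perm_eq [seq m x | x <- finsupp m] (val lam))%:R.

Definition msf_tuple (lam : partition_tuple P) : pseries (P * nat)%type C :=
  \prod_(q <- finsupp lam) msf q (lam q).

End SymmetricFunctions.

Section ArtinSymmetricFunction.
Variables (K : fieldExtType rat) (L : splittingFieldType K).
Variables (C : fieldType) (n : nat) (rho : mx_representation C (galLK L) n).
Variables (pr : primeIdeal K -> primeIdeal L) (sigma : GLK pr).

Local Notation PK := (primeIdeal K).
Local Notation psK := (pseries (PK * nat)%type C).

Definition artin_factor (q : PK) (i : nat) : psK :=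
  (\det (1%:M - psX C (q, i) *: map_mx (@psC _ C) (inv_frep rho pr q sigma)))^-1.

Definition artin_local (q : PK) : psK := psprod (artin_factor q).

Definition artin_sf : psK := psprod artin_local.

Definition artin_term (lam : partition_tuple PK) : psK :=
  psC (\tr (eta_tuple lam (inv_frep rho pr) sigma)) * msf_tuple C lam.

End ArtinSymmetricFunction.

(* Main.v *)
(* The eigenvalues of [rho(sigma_q)] on [V^I] are roots of unity, since [sigma_q]
   lies in a finite group, so this operator is diagonalizable and
   [1 / det(1 - x A) = \sum_k h_k(eigenvalues) x^k = \sum_k Tr(Sym^k A) x^k].
   Write [a_q(k) = Tr(Sym^k(V_q))(sigma_q)]. Since distinct local factors involve
   disjoint sets of variables, the coefficient of the Artin symmetric function at
   a monomial [m] is the product of [a_q(m(q, i))] over the variables [(q, i)] of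
   [m]. It depends only on the tuple of partitions formed by the exponents of [m],
   where it is the trace on [eta_lambda], and [m_lambda] is the sum of all
   monomials with that tuple of exponents. The coefficients lie in a cyclotomic
   field for each [q], hence the homogeneous parts are products of symmetric
   functions over [Q^ab]. *)
From HB Require Import structures.
Require Import Defs.
From mathcomp Require Import all_boot all_order all_algebra all_fingroup all_field all_character.
From mathcomp Require Import finmap.
From mathcomp Require Import boolp classical_sets functions cardinality fsbigop reals.
From mathcomp Require Import complex.
From mathcomp Require Import mpoly.

Import GRing.Theory.

Local Open Scope ring_scope.

Set Implicit Arguments.
Unset Strict Implicit.
Unset Printing Implicit Defensive.

(** * Products of series in disjoint sets of variables *)

Section MonomialRestriction.
Variables (I : choiceType) (R : comNzRingType).
Implicit Types (D : pred I) (m : monom I) (F G : pseries I R).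

Definition mres D m : monom I :=
  [fsfun x in finsupp m => if D x then m x else 0%N | 0%N].

Lemma mresE D m x : mres D m x = if D x then m x else 0%N.
Proof.
by rewrite fsfun_fun; case: ifP => // /negbT /fsfun_dflt ->; case: ifP.
Qed.

Lemma mem_mres D m x : (x \in finsupp (mres D m)) = (x \in finsupp m) && D x.
Proof. by rewrite !mem_finsupp mresE; case: (D x); rewrite ?andbT ?andbF. Qed.

Lemma mres_comp D1 D2 m : {subset D1 <= D2} -> mres D1 (mres D2 m) = mres D1 m.
Proof.
move=> sD; apply/fsfunP => x; rewrite !mresE.
by case: ifP => // D1x; have := sD x D1x; rewrite unfold_in => ->.
Qed.

Lemma mres_all D m : all D (finsupp m) -> mres D m = m.
Proof.
move=> /allP Dm; apply/fsfunP => x; rewrite mresE.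
case: ifP => // /negbT nD; rewrite fsfun_dflt //.
by apply: contra nD => /Dm.
Qed.

Lemma monomM_mres D m : monomM (mres D m) (mres (predC D) m) = m.
Proof. by apply/fsfunP => x; rewrite monomME !mresE /=; case: (D x); rewrite ?addn0. Qed.

Definition supported_on D F := forall m, F m != 0 -> all D (finsupp m).

Lemma psmul_coef F G m :
  (F * G) m = \sum_(p <- fset_set (monom_split m)) F p.1 * G p.2.
Proof. exact: psmulE. Qed.

Lemma in_split m p : (p \in fset_set (monom_split m)) = (monomM p.1 p.2 == m).
Proof.
by rewrite in_fset_set ?in_setE; last exact: finite_monom_split; apply/idP/eqP; rewrite in_setE.
Qed.

(** A monomial splits in only one way into a part in [D] and a part outside [D], so a single term of
    the Cauchy product can be nonzero. *)
Lemma psmul_disjoint D F G m : supported_on D F -> supported_on (predC D) G ->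
  (F * G) m = F (mres D m) * G (mres (predC D) m).
Proof.
move=> sF sG; rewrite psmul_coef.
rewrite (bigD1_seq (mres D m, mres (predC D) m)) ?fset_uniq //=; last first.
  by rewrite in_split monomM_mres.
rewrite big1_seq ?addr0 // => -[u v] /andP[/= ne]; rewrite in_split /= => /eqP uvm.
apply: contraNeq ne => FG.
have Fu : F u != 0 by apply: contraNneq FG => ->; rewrite mul0r.
have Gv : G v != 0 by apply: contraNneq FG => ->; rewrite mulr0.
have /allP Du := sF _ Fu; have /allP Dv := sG _ Gv.
have uD x : ~~ D x -> u x = 0%N.
  by move=> nD; rewrite fsfun_dflt //; apply: contra nD => /Du.
have vD x : D x -> v x = 0%N.
  by move=> Dx; rewrite fsfun_dflt //; apply/negP => /Dv /=; rewrite Dx.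
apply/eqP; congr pair; apply/fsfunP => x; rewrite mresE -uvm monomME /=.
  by case: ifPn => [/vD ->|/uD ->]; rewrite ?addn0.
by case: ifPn => [/uD ->|/negPn/vD ->].
Qed.

(** The map [key] sorts the variables into disjoint classes, one per factor, so the two-factor case
    can be iterated. *)
Lemma psprod_disjoint (T : choiceType) (key : I -> T) (F : T -> pseries I R)
    (s : seq T) m :
    uniq s -> (forall t, t \in s -> supported_on (fun x => key x == t) (F t)) ->
  (\prod_(t <- s) F t) m =
    if all (fun x => key x \in s) (finsupp m)
    then \prod_(t <- s) F t (mres (fun x => key x == t) m) else 0.
Proof.
elim: s m => [|t s IHs] m.
  move=> _ _; rewrite !big_nil.
  change (psC 1 m = if all (fun x => key x \in [::]) (finsupp m) then (1 : R) else 0).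
  rewrite /psC; congr (if _ then _ else _).
  apply/eqP/allP => [-> x|m0]; first by rewrite in_finsupp0.
  apply/fsfunP => x; rewrite fsfun0E; apply: fsfun_dflt.
  by apply/negP => /m0.
move=> /= /andP[ts us] sF; rewrite !big_cons.
have sFs u : u \in s -> supported_on (fun x => key x == u) (F u).
  by move=> us'; apply: sF; rewrite inE us' orbT.
rewrite (@psmul_disjoint (fun x => key x == t)); first last.
- move=> m'; rewrite IHs //; case: ifP; rewrite ?eqxx // => /allP ms _.
  by apply/allP => x /ms xs /=; apply: contra ts => /eqP <-.
- by apply: sF; rewrite mem_head.
rewrite IHs // (_ : all _ (finsupp (mres _ _)) =
    all (fun x => key x \in t :: s) (finsupp m)); last first.
  apply/allP/allP => ms x.
    move=> xm; rewrite inE; case: eqP => //= /eqP xt; apply: ms.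
    by rewrite mem_mres xm.
  by rewrite mem_mres => /andP[/ms] /=; rewrite inE => /orP[->|].
case: ifP => _; last by rewrite mulr0.
congr (_ * _); apply: eq_big_seq => u us'; rewrite mres_comp // => x.
by rewrite !unfold_in => /eqP ->; apply: contra ts => /eqP <-.
Qed.

End MonomialRestriction.

(** * Power series in one variable *)

Section OneVariable.
Variables (I : choiceType) (R : comNzRingType).
Implicit Types (a b : nat -> R) (x : I) (m : monom I).

Definition monomX x k : monom I := [fsfun y in [fset x]%fset => k | 0%N].

Lemma monomXE x k y : monomX x k y = if y == x then k else 0%N.
Proof. by rewrite fsfun_fun inE. Qed.

Lemma monomX_all x m : all (pred1 x) (finsupp m) -> m = monomX x (m x).
Proof.
move=> /allP mx; apply/fsfunP => y; rewrite monomXE; case: eqP => [-> //|/eqP nyx].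
by rewrite fsfun_dflt //; apply: contra nyx => /mx.
Qed.

Lemma all_monomX x k : all (pred1 x) (finsupp (monomX x k)).
Proof.
by apply/allP => y; rewrite mem_finsupp monomXE /=; case: (y == x).
Qed.

(** The series [\sum_k a(k) x^k], seen among the series in all the variables. *)
Definition ser x a : pseries I R :=
  fun m => if all (pred1 x) (finsupp m) then a (m x) else 0.

Lemma serM x a b :
  ser x a * ser x b = ser x (fun k => \sum_(i < k.+1) a i * b (k - i)%N).
Proof.
apply/funext => m; rewrite psmul_coef /ser.
case: ifP => mx; last first.
  rewrite big1_seq // => -[u v] /=; rewrite in_split /= => /eqP uvm.
  case: ifP => ux; last by rewrite mul0r.
  case: ifP => vx; last by rewrite mulr0.
  move: mx; rewrite -uvm (monomX_all ux) (monomX_all vx).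
  move/negP; case; apply/allP => y; rewrite mem_finsupp monomME !monomXE /=.
  by case: (y == x).
pose r := [seq (monomX x i, monomX x (m x - i)%N) | i <- index_iota 0 (m x).+1].
transitivity (\sum_(p <- r) ser x a p.1 * ser x b p.2); last first.
  rewrite big_map big_mkord; apply: eq_bigr => i _.
  by rewrite /ser !all_monomX !monomXE eqxx.
apply: perm_big_supp; apply: uniq_perm.
- by rewrite filter_uniq ?fset_uniq.
- rewrite filter_uniq // map_inj_uniq ?iota_uniq // => i j [] /fsfunP /(_ x).
  by rewrite !monomXE eqxx.
move=> [u v]; rewrite !mem_filter in_split /=; case: eqP => //= /eqP nz.
have [ux vx] : all (pred1 x) (finsupp u) /\ all (pred1 x) (finsupp v).
  move: nz; rewrite /ser /=; case: ifP => _; last by rewrite mul0r eqxx.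
  by case: ifP => _; last by rewrite mulr0 eqxx.
apply/eqP/mapP => /= [uvm|[i + [-> ->]]]; last first.
  rewrite mem_index_iota ltnS => /= im; apply/fsfunP => y.
  rewrite (monomX_all mx) monomME !monomXE eqxx.
  by case: ifP => // _; rewrite subnKC.
have mxE : m x = (u x + v x)%N by rewrite -uvm monomME.
exists (u x); first by rewrite mem_index_iota ltnS mxE leq_addr.
by rewrite mxE addKn -(monomX_all ux) -(monomX_all vx).
Qed.

Lemma ser1 x : ser x (fun k => (k == 0%N)%:R) = 1.
Proof.
apply/funext => m; change (ser x (fun k => (k == 0%N)%:R) m = psC (1 : R) m).
rewrite /ser /psC; case: ifP => mx.
  rewrite (monomX_all mx) monomXE eqxx.
  case: eqP => [->|m0].
    by case: eqP => // -[]; apply/fsfunP => y; rewrite monomXE fsfun0E; case: ifP.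
  by case: eqP => // /fsfunP /(_ x); rewrite monomXE eqxx fsfun0E.
by case: eqP => // m1; move: mx; rewrite m1 finsupp0.
Qed.

End OneVariable.

Section PSConst.
Variables (I : choiceType) (R : comNzRingType).

Lemma psCM_coef (c : R) (F : pseries I R) m : (psC c * F) m = c * F m.
Proof.
(* A constant involves no variable, so it is supported on the empty class. *)
rewrite (@psmul_disjoint _ _ pred0); first last.
- by move=> u _; apply/allP.
- move=> u; rewrite /psC; case: (u =P monom1 I) => [-> _|_]; last by rewrite eqxx.
  by rewrite finsupp0.
rewrite /psC.
have -> : mres pred0 m = monom1 I by apply/fsfunP => x; rewrite mresE fsfun0E.
by rewrite eqxx mres_all //; apply/allP.
Qed.

Fact psC_is_zmod_morphism : zmod_morphism (@psC I R).
Proof.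
move=> a b; apply/funext => m.
change (psC (a - b) m = psC a m - psC b m :> R).
by rewrite /psC; case: ifP; rewrite ?subr0.
Qed.

Fact psC_is_monoid_morphism : monoid_morphism (@psC I R).
Proof.
split=> // a b; apply/funext => m; rewrite psCM_coef.
by rewrite /psC; case: ifP; rewrite ?mulr0.
Qed.

HB.instance Definition _ :=
  GRing.isZmodMorphism.Build R (pseries I R) (@psC I R) psC_is_zmod_morphism.
HB.instance Definition _ :=
  GRing.isMonoidMorphism.Build R (pseries I R) (@psC I R) psC_is_monoid_morphism.

Lemma ser_linear (x : I) (c : R) :
  ser x (fun k => (1 - c *: 'X : {poly R})`_k) = 1 - psX R x * psC c.
Proof.
have -> : psX R x = ser x (fun k => (k == 1%N)%:R).
  apply/funext => m; rewrite /psX /ser.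
  have xE : monomX x 1 = monomU x by [].
  case: ifP => mx; last first.
    by case: eqP => // mE; move: mx; rewrite mE -xE all_monomX.
  rewrite (monomX_all mx) monomXE eqxx -xE; congr (_%:R); congr nat_of_bool.
  apply/eqP/eqP => [/fsfunP/(_ x)|-> //]; by rewrite !monomXE eqxx.
apply/funext => m; rewrite -(ser1 R x) mulrC.
change (ser x (fun k => (1 - c *: 'X : {poly R})`_k) m =
  ser x (fun k => (k == 0%N)%:R) m - (psC c * ser x (fun k => (k == 1%N)%:R)) m).
rewrite psCM_coef /ser; case: ifP => _; last by rewrite mulr0 subr0.
by rewrite coefB coefZ coefX coef1.
Qed.

End PSConst.

(** * Traces on symmetric powers *)

Section CompleteSymmetric.
Variables (F : fieldType) (n : nat) (d : 'rV[F]_n).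

(** The complete homogeneous symmetric polynomial [h_k] at the entries of [d]. *)
Definition complete_sym k : F :=
  \sum_(m : 'X_{1..n < k.+1} | mdeg m == k) \prod_(i < n) d 0 i ^+ m i.

(** Monomials are eigenvectors of the substitution by a diagonal matrix, and the trace adds up their
    eigenvalues. *)
Lemma trace_sym_mx_diag k : \tr (sym_mx k (diag_mx d)) = complete_sym k.
Proof.
transitivity (\sum_(m in sym_basis n k) \prod_(i < n) d 0 i ^+ m i); last first.
  by apply: eq_bigl => m; rewrite inE.
rewrite big_enum_val; apply: eq_bigr => a _; rewrite mxE -/(sym_monom a).
rewrite /linsubst comp_mpolyX.
have -> : \prod_(i < n)
    tnth [tuple \sum_(j < n) diag_mx d i j *: ('X_j : {mpoly F[n]}) | i < n] i
      ^+ sym_monom a i =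
    (\prod_(i < n) d 0 i ^+ sym_monom a i) *: 'X_[sym_monom a].
  rewrite mpolyXE_id -scaler_prod; apply: eq_bigr => i _.
  rewrite tnth_mktuple (bigD1 i) //= big1 ?addr0 => [|j ji].
    by rewrite mxE eqxx mulr1n exprZn.
  by rewrite mxE eq_sym (negPf ji) scale0r.
by rewrite mcoeffZ mcoeffX eqxx mulr1.
Qed.

(* The geometric series are truncated at degree [K] so that the identity
   [\prod_i (1 - d_i t) * \sum_k h_k t^k = 1] can be read off polynomials
   modulo [t^(K+1)]. *)
Definition geom_prod K : {poly F} :=
  \prod_(i < n) \sum_(j < K.+1) (d 0 i ^+ j) *: 'X^j.

(** Expanding the product chooses an exponent at most [K] for each index; as [k <= K], the
    truncation loses no choice of total [k]. *)
Lemma coef_geom_prod K k : (k <= K)%N -> (geom_prod K)`_k = complete_sym k.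
Proof.
move=> kK; rewrite /geom_prod bigA_distr_bigA coef_sum /=.
transitivity (\sum_(f : {ffun 'I_n -> 'I_K.+1} | (\sum_i f i)%N == k)
  \prod_(i < n) d 0 i ^+ f i).
  rewrite [RHS]big_mkcond; apply: eq_bigr => f _.
  rewrite scaler_prod -expr_sum coefZ coefXn eq_sym.
  by case: eqP; rewrite ?mulr1 ?mulr0.
pose h (m : 'X_{1..n < k.+1}) : {ffun 'I_n -> 'I_K.+1} := [ffun i => inord (m i)].
have hE (m : 'X_{1..n < k.+1}) i : h m i = m i :> nat.
  rewrite ffunE inordK // ltnS (leq_trans _ kK) // -ltnS (leq_trans _ (bmdeg m)) //.
  by rewrite ltnS mdegE (bigD1 i) //= leq_addr.
(* The default [bm0] arises only for a total above [k], which the condition on [f] rules out. *)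
pose g (f : {ffun 'I_n -> 'I_K.+1}) : 'X_{1..n < k.+1} :=
  insubd bm0 [multinom (f i : nat) | i < n].
rewrite (reindex_onto h g) => [|f /eqP fk]; last first.
  apply/ffunP => i; apply/val_inj; rewrite /= hE /g val_insubd.
  by rewrite mdegE; under eq_bigr do rewrite mnmE; rewrite fk ltnSn mnmE.
apply: eq_big => [m|m _]; last by apply: eq_bigr => i _; rewrite hE.
rewrite mdegE; under eq_bigr do rewrite hE.
case: eqP => //= mk; apply/eqP/val_inj; rewrite /g val_insubd.
have -> : [multinom (h m i : nat) | i < n] = m by apply/mnmP => i; rewrite mnmE hE.
by rewrite bmdeg.
Qed.

Lemma complete_sym0 : complete_sym 0 = 1.
Proof.
rewrite -(@coef_geom_prod 0) // /geom_prod big1 ?coef1 // => i _.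
by rewrite big_ord1 !expr0 scale1r.
Qed.

Lemma coef_prod_1sub (c : 'I_n -> F) K k : (k <= K)%N ->
  (\prod_(i < n) (1 - c i *: 'X^(K.+1) : {poly F}))`_k = (k == 0%N)%:R.
Proof.
move=> kK; elim/big_rec: _ => [|i p _ IH]; first by rewrite coef1.
rewrite mulrBl mul1r coefB IH -scalerAl coefZ coefXnM ltnS kK.
by rewrite mulr0 subr0.
Qed.

(** Each linear factor times its truncated geometric series telescopes to [1 - (d_j t)^(k+1)], and
    these error terms do not reach degree [k]. *)
Lemma complete_sym_inv k :
  \sum_(i < k.+1) (\prod_(j < n) (1 - d 0 j *: 'X : {poly F}))`_i * complete_sym (k - i) =
  (k == 0%N)%:R.
Proof.
rewrite -(@coef_prod_1sub (fun j => d 0 j ^+ k.+1) k k) //.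
transitivity (((\prod_(j < n) (1 - d 0 j *: 'X)) * geom_prod k)`_k).
  rewrite coefM; apply: eq_bigr => i _.
  by rewrite coef_geom_prod // leq_subr.
rewrite -big_split; apply: (congr1 (fun p : {poly F} => p`_k)); apply: eq_bigr => j _ /=.
transitivity (1 - (d 0 j *: 'X) ^+ k.+1 : {poly F}); last by rewrite exprZn.
rewrite -[RHS]opprB subrX1 -mulNr opprB; congr (_ * _).
by apply: eq_bigr => i _; rewrite exprZn.
Qed.

End CompleteSymmetric.

(** * Matrices of finite order *)

Section FiniteOrder.
Variables (F : fieldType) (n N : nat) (z : F).
Hypothesis z_prim : N.-primitive_root z.

(** [A] is killed by [X^N - 1], whose roots are the [N] distinct powers of [z], so its minimal
    polynomial divides a product of distinct linear factors. *)
Lemma diagonalize_finite_order (A : 'M[F]_n) : A ^+ N = 1%:M ->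
  exists2 P, P \in unitmx & exists2 d : 'rV[F]_n,
    A = invmx P *m diag_mx d *m P & forall i, d 0 i ^+ N = 1.
Proof.
case: n A => [|n'] A AN.
  exists 1%:M; first exact: unitmx1.
  by exists 0; [apply/matrixP => -[] | case].
have [P Pu /(mxpoly.diagonalizable_forLR Pu)[d dE]] : diagonalizable A.
  apply/mxpoly.diagonalizableP; exists [seq z ^+ i | i <- index_iota 0 N].
    rewrite map_inj_in_uniq ?iota_uniq // => i j.
    rewrite !mem_index_iota => /= iN jN /eqP.
    by rewrite (eq_prim_root_expr z_prim) !modn_small // => /eqP.
  rewrite big_map (factor_Xn_sub_1 z_prim); apply: mxminpoly_min.
  rewrite rmorphB rmorphXn rmorph1 /= horner_mx_X.
  by apply/eqP; rewrite subr_eq0; apply/eqP.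
have AE : A = invmx P *m diag_mx d *m P.
  by rewrite {1}dE mxpoly.conjumx ?unitmx_inv // invmxK.
exists P => //; exists d => //.
(* Powers of [A] are diagonal in the same basis; the case [k = N], conjugated back, shows that the
   eigenvalues are [N]-th roots of unity. *)
have AX k : A ^+ k = invmx P *m diag_mx (\row_i d 0 i ^+ k) *m P.
  elim: k => [|k IHk].
    rewrite expr0 -[LHS](mulVmx Pu) -[X in X *m P]mulmx1; congr (_ *m _ *m _).
    by apply/matrixP => i j; rewrite !mxE expr0.
  rewrite exprS IHk {1}AE -[LHS]/(_ *m _) !mulmxA mulmxK //.
  rewrite -[X in X *m P]mulmxA mulmx_diag.
  by congr (_ *m diag_mx _ *m _); apply/rowP => i; rewrite !mxE exprS.
move=> i; move: (AX N); rewrite AN => /(congr1 (fun B => P *m B *m invmx P)).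
rewrite !mulmxA mulmxV // mul1mx mulmxK // mulmx1 mulmxV //.
by move/matrixP/(_ i i); rewrite !mxE eqxx !mulr1n.
Qed.

End FiniteOrder.

Section SymTraceSeries.
Variables (I : choiceType) (F : fieldType) (n : nat).

Lemma trace_sym_conj (P : 'M[F]_n) (d : 'rV[F]_n) k : P \in unitmx ->
  \tr (sym_mx k (invmx P *m diag_mx d *m P)) = complete_sym d k.
Proof.
move=> Pu; rewrite -trace_sym_mx_diag.
by rewrite -mulmxA sym_mxM mxtrace_mulC -sym_mxM -mulmxA mulmxV // mulmx1.
Qed.

Lemma ser_prod_linear (x : I) (d : 'rV[F]_n) :
  \prod_(j < n) (1 - psX F x * psC (d 0 j)) =
  ser x (fun k => (\prod_(j < n) (1 - d 0 j *: 'X : {poly F}))`_k).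
Proof.
elim/big_rec2: _ => [|j p s _ ->].
  rewrite -(ser1 F x); congr ser; apply/funext => k; by rewrite coef1.
rewrite -ser_linear serM; congr ser; apply/funext => k; by rewrite coefM.
Qed.

(** Conjugation by [P] turns the determinant into [\prod_j (1 - d_j x)], whose inverse is the
    generating series of the [h_k], that is, of the traces on symmetric powers. *)
Lemma inv_det_1sub (x : I) (P : 'M[F]_n) (d : 'rV[F]_n) (A := invmx P *m diag_mx d *m P) :
    P \in unitmx ->
  (\det (1%:M - psX F x *: map_mx (@psC I F) A))^-1 =
  ser x (fun k => \tr (sym_mx k A)).
Proof.
move=> Pu; have -> : (fun k => \tr (sym_mx k A)) = complete_sym d.
  by apply/funext => k; rewrite trace_sym_conj.
have -> : \det (1%:M - psX F x *: map_mx (@psC I F) A) =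
    \prod_(j < n) (1 - psX F x * psC (d 0 j)).
  pose Q := map_mx (@psC I F) P; pose Q' := map_mx (@psC I F) (invmx P).
  have QQ' : Q *m Q' = 1%:M by rewrite -map_mxM mulmxV // map_mx1.
  have Q'Q : Q' *m Q = 1%:M by rewrite -map_mxM mulVmx // map_mx1.
  have -> : 1%:M - psX F x *: map_mx (@psC I F) A =
      Q' *m (1%:M - psX F x *: diag_mx (map_mx (@psC I F) d)) *m Q.
    rewrite mulmxBr mulmx1 mulmxBl Q'Q -scalemxAr -scalemxAl.
    by rewrite /A !map_mxM map_diag_mx.
  rewrite -mulmxA det_mulmx det_mulmx mulrCA -det_mulmx Q'Q det1 mulr1.
  have -> : 1%:M - psX F x *: diag_mx (map_mx (@psC I F) d) =
      diag_mx (\row_j (1 - psX F x * psC (d 0 j))).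
    apply/matrixP => i j; rewrite !mxE.
    by case: eqP => [->|_]; rewrite ?mulr1n // !mulr0n mulr0 subr0.
  by rewrite det_diag; apply: eq_bigr => j _; rewrite mxE.
rewrite ser_prod_linear; apply: mulr1_eq.
rewrite serM -(ser1 F x); congr ser; apply/funext => k.
exact: complete_sym_inv.
Qed.

End SymTraceSeries.

(** * Infinite sums and products *)

Section Limits.
Variables (I : choiceType) (R : comNzRingType) (T : choiceType).

(** Two finite index sets lie in a common one, their union. This makes the limits picked by [psprod]
    and [pssum] unambiguous. *)
Lemma pslim_unique (u : {fset T} -> pseries I R) F G :
  is_pslim u F -> is_pslim u G -> F = G.
Proof.
move=> uF uG; apply/funext => m.
have [S1 uF1] := uF m; have [S2 uG2] := uG m.
rewrite -(uF1 (S1 `|` S2)%fset) ?fsubsetUl //.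
by rewrite (uG2 (S1 `|` S2)%fset) ?fsubsetUr.
Qed.

Lemma psprodE (f : T -> pseries I R) F : has_prod f F -> psprod f = F.
Proof.
move=> fF; rewrite /psprod; case: xgetP => [G _ /= fG|/(_ F)//].
exact: pslim_unique fG fF.
Qed.

Lemma pssumE (f : T -> pseries I R) F : has_sum f F -> pssum f = F.
Proof.
move=> fF; rewrite /pssum; case: xgetP => [G _ /= fG|/(_ F)//].
exact: pslim_unique fG fF.
Qed.

Lemma pssum_coef (s : seq T) (f : T -> pseries I R) m :
  (\sum_(t <- s) f t) m = \sum_(t <- s) f t m.
Proof. exact: (big_morph (fun F : pseries I R => F m)). Qed.

End Limits.

(** * Series with multiplicative coefficients *)

Section MultiplicativeSeries.
Variables (I : choiceType) (R : comNzRingType) (g : I -> nat -> R).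
Implicit Types (D : pred I) (m : monom I) (F : pseries I R).

(** The effect of setting all variables outside [D] to 0. *)
Definition ps_restrict D F : pseries I R :=
  fun m => if all D (finsupp m) then F m else 0.

Lemma ps_restrict_supported D F : supported_on D (ps_restrict D F).
Proof. by move=> m; rewrite /ps_restrict; case: ifP; rewrite ?eqxx. Qed.

Lemma eq_ps_restrict D1 D2 F : D1 =1 D2 -> ps_restrict D1 F = ps_restrict D2 F.
Proof. by move=> D12; apply/funext => m; rewrite /ps_restrict (eq_all D12). Qed.

(** When every [g x 0] is 1, this is the expansion of the product over all [x] of the series
    [\sum_k g x k * x^k]. *)
Definition mult_series : pseries I R := fun m => \prod_(x <- finsupp m) g x (m x).

Lemma perm_finsupp_mres D m :
  perm_eq (finsupp (mres D m)) [seq x <- finsupp m | D x].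
Proof.
apply: uniq_perm; rewrite ?filter_uniq ?fset_uniq // => x.
by rewrite mem_filter mem_mres andbC.
Qed.

Lemma mult_series_mres D m :
  mult_series (mres D m) = \prod_(x <- finsupp m | D x) g x (m x).
Proof.
rewrite /mult_series (perm_big _ (perm_finsupp_mres D m)) big_filter.
by apply: eq_bigr => x Dx; rewrite mresE Dx.
Qed.

Lemma prod_fibers (T : choiceType) (key : I -> T) (s : seq T) (r : seq I)
    (G : I -> R) : uniq s -> all (fun x => key x \in s) r ->
  \prod_(t <- s) \prod_(x <- r | key x == t) G x = \prod_(x <- r) G x.
Proof.
move=> us /allP rs.
rewrite (exchange_big_dep predT) //=; apply: eq_big_seq => x /rs xs.
rewrite big_mkcond (bigD1_seq (key x)) //= eqxx big1 ?mulr1 // => t.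
by rewrite eq_sym => /negPf ->.
Qed.

(** A monomial meets finitely many classes of [key]; once [S] contains them, further factors
    contribute only their constant coefficient 1. *)
Lemma has_prod_mult_series (T : choiceType) (key : I -> T) D :
  has_prod (fun t => ps_restrict (fun x => D x && (key x == t)) mult_series)
           (ps_restrict D mult_series).
Proof.
move=> m; exists [fset key x | x in finsupp m]%fset => S /fsubsetP keyS.
rewrite (psprod_disjoint (key := key)) ?fset_uniq => [|//|t _]; last first.
  move=> u /ps_restrict_supported /allP Du; apply/allP => x /Du.
  by case/andP.
have mS : all (fun x => key x \in S) (finsupp m).
  by apply/allP => x xm; apply: keyS; apply: in_imfset.
rewrite mS; rewrite [RHS]/ps_restrict; case: ifP => [Dm|/negbT/allPn[x xm nDx]].
  rewrite -[RHS](prod_fibers _ (fset_uniq S) mS); apply: eq_bigr => t _.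
  rewrite /ps_restrict ifT ?mult_series_mres //.
  apply/allP => x; rewrite mem_mres => /andP[xm ->].
  by rewrite andbT (allP Dm).
rewrite (bigD1_seq (key x)) ?fset_uniq /= ?(allP mS) //.
rewrite /ps_restrict ifN ?mul0r //; apply/allPn; exists x.
  by rewrite mem_mres xm /=.
by rewrite (negPf nDx).
Qed.

Hypothesis g0 : forall x, g x 0%N = 1.

(** The hypothesis on [g x 0] gives agreement at the monomial 1, where the multiplicative
    coefficient is an empty product. *)
Lemma ser_mult_series x : ser x (g x) = ps_restrict (pred1 x) mult_series.
Proof.
apply/funext => m; rewrite /ser /ps_restrict; case: ifP => // mx.
rewrite /mult_series; case: (boolP (x \in finsupp m)) => xm.
  rewrite (bigD1_seq x) ?fset_uniq //= big1_seq ?mulr1 // => y /andP[yx /(allP mx)].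
  by rewrite /= (negPf yx).
rewrite big1_seq; first by rewrite fsfun_dflt // g0.
by move=> y /= ym; have /= /eqP yx := allP mx y ym; rewrite -yx ym in xm.
Qed.

End MultiplicativeSeries.

Section EtaTrace.
Variables (P : choiceType) (F : fieldType) (G : groupType) (g : G).

Lemma trace_eta (lam : Defs.partition) (W : frep F G) :
  \tr (eta lam W g) = \prod_(k <- val lam) \tr (sym_mx k (W g)).
Proof.
rewrite /eta; elim: (val lam) => [|k s IHs]; first by rewrite big_nil /= mxtrace1.
by rewrite big_cons -IHs; exact: mxtrace_prod.
Qed.

Lemma trace_eta_tuple (lam : partition_tuple P) (V : P -> frep F G) :
  \tr (eta_tuple lam V g) =
  \prod_(q <- finsupp lam) \prod_(k <- val (lam q)) \tr (sym_mx k (V q g)).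
Proof.
rewrite /eta_tuple (big_morph (fun W : frep F G => \tr (W g)) (id1 := 1) (op1 := *%R)).
- by apply: eq_bigr => q _; exact: trace_eta.
- by move=> U W; exact: mxtrace_prod.
- by rewrite /= mxtrace1.
Qed.

End EtaTrace.

(** * Exponent types and monomial symmetric functions *)

Section ExponentType.
Variables (P : choiceType) (C : fieldType).
Implicit Types (m : monom (P * nat)%type) (q : P).

Definition exponents m q : seq nat :=
  sort geq [seq m x | x <- finsupp m & x.1 == q].

Lemma exponents_is_partition m q : is_partition (exponents m q).
Proof.
apply/andP; split; first by apply: sort_sorted => a b; exact: leq_total.
rewrite mem_sort; apply/mapP => -[x]; rewrite mem_filter mem_finsupp.
by case/andP => _ mx /esym/eqP; rewrite (negPf mx).
Qed.

(** The only tuple whose monomial symmetric function contains [m]. *)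
Definition exponent_type m : partition_tuple P :=
  [fsfun q in [fset x.1 | x in finsupp m]%fset =>
    exist _ (exponents m q) (exponents_is_partition m q) : Defs.partition
  | empty_partition].

Lemma exponent_typeE m q : val (exponent_type m q) = exponents m q.
Proof.
rewrite fsfun_fun; case: ifP => // /negbT qm; rewrite /exponents.
rewrite (_ : [seq x <- finsupp m | x.1 == q] = [::]) //.
apply/eqP; rewrite -[_ == _]negbK -has_filter; apply/hasP => -[x xm /eqP xq].
by case/negP: qm; rewrite -xq; apply: in_imfset.
Qed.

Lemma exponent_type_supp m x : x \in finsupp m -> x.1 \in finsupp (exponent_type m).
Proof.
move=> xm; rewrite mem_finsupp; apply/eqP => /(congr1 val).
rewrite exponent_typeE /= => /(congr1 (fun s : seq nat => m x \in s)).
by rewrite mem_sort in_nil => /negP[]; apply: map_f; rewrite mem_filter eqxx.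
Qed.

(** A partition is already sorted, so being a rearrangement of it amounts to equality after
    sorting. *)
Lemma msf_coef q (lam : Defs.partition) m : msf C q lam (mres (fun x => x.1 == q) m) =
  (exponents m q == val lam)%:R.
Proof.
rewrite /msf; congr (_%:R); congr nat_of_bool.
rewrite (_ : all _ _ = true) /=; last first.
  by apply/allP => x; rewrite mem_mres => /andP[].
pose mq := mres (fun x => x.1 == q) m.
have -> : perm_eq [seq mq x | x <- finsupp mq] =1
    perm_eq [seq m x | x <- finsupp m & x.1 == q].
  apply/permPl; rewrite (perm_trans (perm_map _ (perm_finsupp_mres _ _))) //.
  rewrite (_ : map _ _ = [seq m x | x <- finsupp m & x.1 == q]) //.
  by apply/eq_in_map => x; rewrite mem_filter mresE => /andP[->].
have geq_tr : transitive geq by move=> a b c /= ba ca; exact: leq_trans ca ba.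
have geq_anti : antisymmetric geq by move=> a b; rewrite /geq /= andbC => /anti_leq.
have geq_tot : total geq by move=> a b; exact: leq_total.
have sl : sort geq (val lam) = val lam.
  by apply: sorted_sort => //; case/andP: (valP lam).
apply/(perm_sortP geq_tot geq_tr geq_anti)/eqP; rewrite sl; exact: id.
Qed.

(** The alphabets are disjoint, so the coefficient is a product of local tests, each comparing
    [lam q] with the exponents of [m] in the alphabet [q]. *)
Lemma msf_tuple_coef (lam : partition_tuple P) m :
  msf_tuple C lam m = (lam == exponent_type m)%:R.
Proof.
rewrite /msf_tuple (psprod_disjoint (key := fst)) ?fset_uniq //; last first.
  move=> q _ u; rewrite /msf; case: (all _ _) => //=.
  by rewrite eqxx.
have [->|ne] := eqVneq.
  rewrite ifT; last by apply/allP => x /exponent_type_supp.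
  by rewrite big1 // => q _; rewrite msf_coef exponent_typeE eqxx.
case: ifP => // /allP ml; apply/eqP; rewrite -[_ == 0]negbK; apply/negP => nz.
case/eqP: ne; apply/fsfunP => q; apply: val_inj; rewrite exponent_typeE.
have [ql|ql] := boolP (q \in finsupp lam).
  apply/eqP; rewrite eq_sym -[_ == _]negbK; apply/negP => ne.
  case/negP: nz; rewrite (bigD1_seq q) ?fset_uniq //= msf_coef (negPf ne).
  by rewrite mul0r.
(* Over [q] outside the support of [lam] the monomial has no variables, so both partitions are
   empty. *)
rewrite fsfun_dflt //= /exponents (_ : [seq x <- finsupp m | x.1 == q] = [::]) //.
apply/eqP; rewrite -[_ == _]negbK -has_filter; apply/hasP => -[x xm /eqP xq].
by case/negP: ql; rewrite -xq; exact: ml.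
Qed.

Lemma prod_exponent_type (a : P -> nat -> C) m :
  \prod_(q <- finsupp (exponent_type m)) \prod_(k <- val (exponent_type m q)) a q k =
  mult_series (fun x => a x.1) m.
Proof.
rewrite /mult_series -(prod_fibers (key := fst) (s := finsupp (exponent_type m)));
  rewrite ?fset_uniq //; last first.
  by apply/allP => x /exponent_type_supp.
apply: eq_bigr => q _; rewrite exponent_typeE.
rewrite (perm_big _ (permEl (perm_sort _ _))) big_map big_filter.
by apply: eq_bigr => x /eqP ->.
Qed.

(** At [m] only the index [exponent_type m] contributes, so the partial sums are constant once it is
    included. *)
Lemma has_sum_exponent_type (c : partition_tuple P -> C) :
  has_sum (fun lam => psC (c lam) * msf_tuple C lam) (fun m => c (exponent_type m)).
Proof.
move=> m; exists [fset exponent_type m]%fset => S; rewrite fsub1set => mS.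
rewrite pssum_coef (bigD1_seq (exponent_type m)) ?fset_uniq //=.
rewrite psCM_coef msf_tuple_coef eqxx mulr1 big1 ?addr0 // => lam ne.
by rewrite psCM_coef msf_tuple_coef (negPf ne) mulr0.
Qed.

End ExponentType.

(** * Homogeneous parts and cyclotomic coefficients *)

(** [w] is sent to a root [z] in [C] of its minimal polynomial over the rationals, and a polynomial
    in [w] to the same polynomial in [z]. *)
Lemma simple_ext_embedding (C : numClosedFieldType) (E : fieldExtType rat) (w : E) :
  <<1; w>>%VS = fullv -> inhabited {rmorphism E -> C}.
Proof.
move=> wE.
have /polyOver1P[p0 p0E] := minPolyOver 1%AS w.
have [z /rootP pz0] : exists z : C, root (map_poly ratr p0) z.
  apply: closed_rootP; rewrite size_map_poly -(size_map_poly (in_alg E)).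
  by rewrite -p0E size_minPoly eqSS; have := adjoin_degreeE.
(* A polynomial vanishing at [w] is a multiple of the minimal polynomial, hence vanishes at [z]. *)
have ev0 (p : {poly rat}) : (map_poly (in_alg E) p).[w] = 0 ->
    (map_poly (ratr : rat -> C) p).[z] = 0.
  move=> pw; have : minPoly 1 w %| map_poly (in_alg E) p.
    apply: minPoly_dvdp; last exact/rootP.
    by apply/polyOver1P; exists p.
  rewrite p0E dvdp_map => /Pdiv.Field.dvdpP[r ->].
  by rewrite rmorphM hornerM pz0 mulr0.
have ex (x : E) : exists p : {poly rat}, x = (map_poly (in_alg E) p).[w].
  by apply/Fadjoin1_polyP; rewrite wE memvf.
pose px x := sval (cid (ex x)).
have pxE x : x = (map_poly (in_alg E) (px x)).[w] := svalP (cid (ex x)).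
pose f x := (map_poly (ratr : rat -> C) (px x)).[z].
(* The value is independent of the representing polynomial, so sums and products can be computed on
   any representatives. *)
have fE (p : {poly rat}) x :
    x = (map_poly (in_alg E) p).[w] -> f x = (map_poly ratr p).[z].
  move=> xE; apply/eqP; rewrite -subr_eq0 /f -hornerN -hornerD -raddfB; apply/eqP.
  by apply: ev0; rewrite raddfB hornerD hornerN -pxE -xE subrr.
have fB : zmod_morphism f.
  move=> x y; rewrite (fE (px x - px y)) ?raddfB ?hornerD ?hornerN //=.
  by rewrite -!pxE.
have fM : monoid_morphism f.
  split=> [|x y].
    by rewrite (fE 1) rmorph1 hornerC.
  by rewrite (fE (px x * px y)) ?rmorphM ?hornerM //= -!pxE.
pose fA := GRing.isZmodMorphism.Build _ _ f fB.
pose fR := GRing.isMonoidMorphism.Build _ _ f fM.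
by constructor; exact: (HB.pack_for {rmorphism E -> C} f fA fR).
Qed.

(** The field is generated by a primitive [N]-th root of unity. Every automorphism raises it to some
    power, and such operations commute. *)
Lemma cyclotomic_embedding (C : numClosedFieldType) N : (0 < N)%N ->
  exists (E : splittingFieldType rat) (iota : {rmorphism E -> C}) (w : E),
    [/\ galois 1%AS {:E}, abelian 'Gal({:E} / 1%AS) & N.-primitive_root w].
Proof.
move=> N0; have [E galE [_ _ [w [w_prim wE] _]]] := group_num_field_exists (Zp N).
rewrite card_Zp // in w_prim.
have [iota] := simple_ext_embedding C wE.
exists E, iota, w; split => //; apply/centsP => s sG t tG.
have gw u : u \in 'Gal({:E} / 1%AS)%g -> exists k, u w = w ^+ k.
  move=> uG; have [|k ->] := prim_rootP w_prim (x := u w); last by exists k.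
  by rewrite -rmorphXn (prim_expr_order w_prim) rmorph1.
have [i si] := gw s sG; have [j tj] := gw t tG.
apply/eqP/gal_eqP => x _.
have /Fadjoin1_polyP[p ->] : x \in <<1; w>>%VS by rewrite wE memvf.
have fixp u : u \in 'Gal({:E} / 1%AS)%g ->
    map_poly u (map_poly (in_alg E) p) = map_poly (in_alg E) p.
  by move=> uG; apply: (fixedPoly_gal (sub1v _) uG); apply/polyOver1P; exists p.
have ev u y : u \in 'Gal({:E} / 1%AS)%g ->
    u (map_poly (in_alg E) p).[y] = (map_poly (in_alg E) p).[u y].
  by move=> uG; rewrite -{2}(fixp u uG) horner_map.
rewrite !galM ?memvf // !ev //; congr (_.[_]).
by rewrite si tj !(rmorphXn _ _ w) /= si tj -!exprM mulnC.
Qed.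

Section HomogeneousParts.
Variables (P : choiceType) (C : fieldType) (a : P -> nat -> C).
Implicit Types (m : monom (P * nat)%type) (q : P).

(** One abelian field holds all the values at once, so that their products stay inside it without
    forming composita. *)
Definition in_one_Qab (c : nat -> C) : Prop :=
  exists (E : splittingFieldType rat) (iota : {rmorphism E -> C}),
    [/\ galois 1%AS {:E}, abelian 'Gal({:E} / 1%AS)
      & forall k, exists e, c k = iota e].

Let F : pseries (P * nat)%type C := mult_series (fun x => a x.1).

Definition local_homog (k : nat) q : pseries (P * nat)%type C :=
  fun m => if all (fun x => x.1 == q) (finsupp m) && (totdeg m == k) then F m else 0.

Lemma totdeg_mres q m : totdeg (mres (fun x => x.1 == q) m) = multideg m q.
Proof.
rewrite /totdeg /multideg (perm_big _ (perm_finsupp_mres _ m)) big_filter.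
by apply: eq_bigr => x xq; rewrite mresE xq.
Qed.

(** The coefficients depend only on the multiset of exponents in one alphabet, and each nonzero one
    is a finite product of values of [a q]. *)
Lemma local_homog_sym k q : in_one_Qab (a q) -> sym_fun q (local_homog k q).
Proof.
move=> [E [iota [galE abE aE]]]; split.
- move=> m; exists E, iota; split => //; rewrite /local_homog.
  case: ifP => [/andP[/allP mq _]|_]; last by exists 0; rewrite rmorph0.
  rewrite /F /mult_series big_seq.
  elim/big_rec: _ => [|x _ xm [e ->]]; first by exists 1; rewrite rmorph1.
  rewrite (eqP (mq x xm)); have [e' ->] := aE (m x).
  by exists (e' * e); rewrite rmorphM.
- move=> m x; rewrite /local_homog; case: ifP => [/andP[/allP mq _] _ /mq /eqP //|].
  by rewrite eqxx.
- exists k => m; rewrite /local_homog; case: ifP => [/andP[_ /eqP -> //]|].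
  by rewrite eqxx.
move=> s m m' sbij mm' mm'q.
(* [f] extends [s] to all variables, fixing the other alphabets; it carries the support of [m'] onto
   that of [m]. *)
pose f (x : P * nat) := if x.1 == q then (q, s x.2) else x.
have m'E x : m' x = m (f x).
  by case: x => u i; rewrite /f /=; case: eqP => [->|/eqP uq]; rewrite ?mm' ?mm'q.
have f1 x : (f x).1 = x.1 by rewrite /f; case: eqP.
have finj : injective f.
  move=> [u i] [v j]; rewrite /f /=.
  case: eqP => [->|uq]; case: eqP => [->|vq] //.
  - by move=> [/(bij_inj sbij) ->].
  - by move=> [qv _]; case: vq.
  - by move=> [uq' _]; case: uq.
have fperm : perm_eq (finsupp m) [seq f x | x <- finsupp m'].
  apply: uniq_perm; rewrite ?map_inj_uniq ?fset_uniq // => x.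
  apply/idP/mapP => [xm|[y + ->]]; last by rewrite !mem_finsupp m'E.
  have [t _ ts] := sbij.
  exists (if x.1 == q then (q, t x.2) else x); last first.
    case: x {xm} => u i; rewrite /f /=.
    by case: (u =P q) => [->|/eqP/negPf uq] /=; rewrite ?eqxx ?ts ?uq.
  rewrite mem_finsupp m'E; move: xm; rewrite mem_finsupp /f.
  by case: x => u i /=; case: (u =P q) => [->|/eqP/negPf uq] /=; rewrite ?eqxx ?ts ?uq.
have -> : local_homog k q m = local_homog k q m'; last by [].
rewrite /local_homog /totdeg /F /mult_series (perm_all _ fperm) !(perm_big _ fperm) /=.
rewrite !big_map all_map.
rewrite (eq_all (a2 := fun x => x.1 == q)) => [|x]; last by rewrite /= f1.
rewrite (eq_bigr (fun x => m' x)) => [|x _]; last by rewrite m'E.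
by case: ifP => // _; apply: eq_bigr => x _; rewrite f1 m'E.
Qed.

(** For [d] of finite support, the part of multidegree [d] is a single product of local homogeneous
    parts, over the [q] with [d q] nonzero. *)
Lemma mult_series_in_AK : (forall q, in_one_Qab (a q)) -> in_AK F.
Proof.
move=> aQ d.
have [fin|nfin] := pselect (finite_set [set q | d q <> 0%N]%classic).
  pose S := fset_set [set q | d q <> 0%N]%classic.
  have inS q : (q \in S) = (d q != 0%N).
    by rewrite in_fset_set //; apply/idP/idP => [|/eqP dq]; rewrite in_setE // => /eqP.
  exists 1%N, (fun=> S), (fun _ q => local_homog (d q) q).
  split=> [_ q|]; first exact: local_homog_sym.
  rewrite big_ord1; apply/funext => m.
  rewrite (psprod_disjoint (key := fst)) ?fset_uniq //; last first.
    by move=> q _ u; rewrite /local_homog; case: ifP => [/andP[]//|]; rewrite eqxx.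
  rewrite /homog_part.
  have md q : (forall x, x \in finsupp m -> x.1 != q) -> multideg m q = 0%N.
    move=> mq; rewrite /multideg big_seq_cond big1 // => x /andP[/mq/negPf ->] //.
  have md0 x : x \in finsupp m -> multideg m x.1 != 0%N.
    move=> xm; rewrite /multideg big_mkcond (bigD1_seq x) ?fset_uniq //= eqxx.
    by rewrite addn_eq0 negb_and; move: xm; rewrite mem_finsupp => ->.
  have lE q : local_homog (d q) q (mres (fun x => x.1 == q) m) =
      if multideg m q == d q then F (mres (fun x => x.1 == q) m) else 0.
    rewrite /local_homog totdeg_mres (_ : all _ _ = true) //.
    by apply/allP => x; rewrite mem_mres => /andP[].
  have [mdE|mdE] := asboolP.
    have mS : all (fun x => x.1 \in S) (finsupp m).
      by apply/allP => x xm; rewrite inS -mdE md0.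
    rewrite mS /F -[LHS](prod_fibers (key := fst) _ (fset_uniq S) mS).
    by apply: eq_bigr => q _; rewrite lE mdE eqxx /F mult_series_mres.
  (* A nonzero product would force the multidegree of [m] to be [d]: on [S] by the factors, outside
     [S] because both are 0. *)
  case: ifP => // /allP mS; apply/esym/eqP; rewrite -[_ == _]negbK; apply/negP => nz.
  apply: mdE; apply/funext => q; have [qS|] := boolP (q \in S).
    apply/eqP; rewrite -[_ == _]negbK; apply/negP => ne; case/negP: nz.
    by rewrite (bigD1_seq q) ?fset_uniq //= lE (negPf ne) mul0r.
  move=> qS; rewrite md => [|x /mS xS]; last by apply: contraNneq qS => <-.
  by move: qS; rewrite inS negbK => /eqP ->.
(* For [d] of infinite support the part is the empty sum, since a monomial meets only finitely many
   alphabets. *)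
exists 0%N, (fun=> fset0), (fun _ _ => 0); split=> [[]//|].
rewrite big_ord0; apply/funext => m; rewrite /homog_part.
have [mdE|//] := asboolP; case: nfin.
apply: (@sub_finite_set _ _ [set` [fset x.1 | x in finsupp m]%fset]) => //= q.
rewrite -mdE => /= /eqP; apply: contraNT => qm.
apply/eqP; rewrite /multideg big_seq_cond big1 // => x /andP[xm /eqP xq].
by case/negP: qm; rewrite /= -xq; apply: in_imfset.
Qed.

End HomogeneousParts.

(** The eigenvalues are powers of one root of unity from an abelian field, and [h_k] is a polynomial
    in them with integer coefficients. *)
Lemma finite_order_trace_sym (C : numClosedFieldType) n (A : 'M[C]_n) N :
    (0 < N)%N -> A ^+ N = 1%:M ->
  (exists P (d : 'rV[C]_n), P \in unitmx /\ A = invmx P *m diag_mx d *m P) /\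
  in_one_Qab (fun k => \tr (sym_mx k A)).
Proof.
move=> N0 AN; have [E [iota [w [galE abE w_prim]]]] := cyclotomic_embedding C N0.
have z_prim : N.-primitive_root (iota w) by rewrite fmorph_primitive_root.
have [P Pu [d AE dN]] := diagonalize_finite_order z_prim AN.
split; first by exists P, d.
exists E, iota; split => // k; rewrite AE trace_sym_conj // /complete_sym.
elim/big_rec: _ => [|m _ _ [e ->]]; first by exists 0; rewrite rmorph0.
suff [e' ->] : exists e', \prod_(i < n) d 0 i ^+ m i = iota e'.
  by exists (e' + e); rewrite rmorphD.
elim/big_rec: _ => [|i _ _ [e' ->]]; first by exists 1; rewrite rmorph1.
have [j ->] := prim_rootP z_prim (dN i).
by exists ((w ^+ j) ^+ m i * e'); rewrite rmorphM !rmorphXn.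
Qed.

(** * The Artin symmetric function *)

Lemma inv_frep_finite_order (C : fieldType) (K : fieldExtType rat)
    (L : splittingFieldType K) n (rho : mx_representation C (galLK L) n)
    (pr : primeIdeal K -> primeIdeal L) (sigma : GLK pr) q :
  inv_frep rho pr q sigma ^+ #[sgval (sigma q)]%g = 1%:M.
Proof.
have H := subgP (sigma q).
rewrite -[RHS](repr_mx1 (inv_repr rho (pr q))) -(expg_order (sgval (sigma q))).
elim: #[_]%g => [|k IHk]; first by rewrite expr0 expg0 repr_mx1.
by rewrite exprS expgS repr_mxM ?groupX // IHk.
Qed.

Theorem proposition3p15 (R : realType) (K : fieldExtType rat)
    (L : splittingFieldType K) (hLK : galois 1%AS {:L})
    (n : nat) (rho : mx_representation R[i] (galLK L) n)
    (pr : primeIdeal K -> primeIdeal L)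
    (hpr : forall q, lies_over (pr q) q)
    (sigma : GLK pr)
    (hsigma : forall q, is_Frobenius q (sgval (sigma q))) :
  [/\ forall q, prodable (artin_factor rho sigma q),
      prodable (artin_local rho sigma),
      summable (artin_term rho sigma),
      in_AK (artin_sf rho sigma)
    & artin_sf rho sigma = pssum (artin_term rho sigma)].
Proof.
pose a q k := \tr (sym_mx k (inv_frep rho pr q sigma)).
have ord q := finite_order_trace_sym (order_gt0 _) (inv_frep_finite_order rho sigma q).
have a0 q : a q 0%N = 1.
  have [[P [d [Pu AE]]] _] := ord q.
  by rewrite /a AE trace_sym_conj // complete_sym0.
(* [F] will be the common value of the product and of the sum. *)
pose F : pseries (primeIdeal K * nat)%type R[i] := mult_series (fun x => a x.1).
(* By the generating series of symmetric power traces, each inverse determinant is [F] with all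
   variables but [(q, i)] set to 0. *)
have factorE q i : artin_factor rho sigma q i =
    ps_restrict (fun x => (x.1 == q) && (x.2 == i)) F.
  have [[P [d [Pu AE]]] _] := ord q.
  rewrite /artin_factor AE inv_det_1sub // -AE.
  transitivity (ps_restrict (pred1 (q, i)) F).
    by rewrite -(ser_mult_series (g := fun x => a x.1)).
  by apply: eq_ps_restrict => -[].
(* Within one alphabet the classes are single variables, told apart by [snd]; in the next product
   they are alphabets, told apart by [fst]. *)
have has_local q : has_prod (artin_factor rho sigma q) (ps_restrict (fun x => x.1 == q) F).
  rewrite (_ : artin_factor rho sigma q =
    (fun i => ps_restrict (fun x => (x.1 == q) && (x.2 == i)) F)); last exact/funext.
  exact: (has_prod_mult_series _ snd).
have localE q : artin_local rho sigma q = ps_restrict (fun x => x.1 == q) F.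
  exact: psprodE (has_local q).
have has_sf : has_prod (artin_local rho sigma) F.
  rewrite (_ : artin_local rho sigma =
    (fun q => ps_restrict (fun x => predT x && (x.1 == q)) F)); last exact/funext.
  rewrite -[F in has_prod _ F](_ : ps_restrict predT F = F).
    exact: (has_prod_mult_series _ fst).
  by apply/funext => m; rewrite /ps_restrict all_predT.
have sfE : artin_sf rho sigma = F by apply: psprodE.
(* Each coefficient of [F] is the trace attached to the exponent type of its monomial, as in a sum
   of monomial symmetric functions. *)
have has_term : has_sum (artin_term rho sigma) F.
  rewrite [F in has_sum _ F](_ : _ = fun m =>
    \tr (eta_tuple (exponent_type m) (inv_frep rho pr) sigma)); last first.
    by apply/funext => m; rewrite trace_eta_tuple prod_exponent_type.
  exact: has_sum_exponent_type.
split.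
- by move=> q; exists (ps_restrict (fun x => x.1 == q) F).
- by exists F.
- by exists F.
- by rewrite sfE; apply: mult_series_in_AK => q; have [] := ord q.
- by rewrite sfE (pssumE has_term).
Qed.
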